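(* Let $p$ be a prime number. For every positive integer $n$ and every $\xi\in\mathbb{Q}_p$ transcendental over $\mathbb{Q}$, we have $$\widehat{w}_{n}(\xi)\leq 2n-1 \qquad\text{and}\qquad \widehat{\lambda}_{n}(\xi)\leq \left\lceil \frac{n}{2}\right\rceil^{-1}.$$
   Context: $|\cdot|_p$ is the usual $p$-adic absolute value on $\mathbb{Q}_p$, normalized by $|p|_p=p^{-1}$, and $\lceil\cdot\rceil$ is the ceiling function. For an integer $n\ge 1$ and $\xi\in\mathbb{Q}_p$: $\widehat{w}_n(\xi)$ is the supremum of the real numbers $\widehat{w}$ such that, for every sufficiently large real number $X$, the inequalities $$\max\{|x_0|,\ldots,|x_n|\}\le X,\qquad 0<|x_n\xi^n+\cdots+x_1\xi+x_0|_p\le X^{-\widehat{w}-1}$$ have a solution in integers $x_0,\ldots,x_n$. $\widehat{\lambda}_n(\xi)$ is the supremum of the real numbers $\widehat{\lambda}$ such that, for every sufficiently large real number $X$, the inequalities $$\max\{|x_0|,\ldots,|x_n|\}\le X,\qquad 0<\max_{1\le m\le n}|x_0\xi^m-x_m|_p\le X^{-\widehat{\lambda}-1}$$ have a solution in integers $x_0,\ldots,x_n$. *)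

(* Defs.v *)
From HB Require Import structures.
From mathcomp Require Import all_boot all_order all_algebra.
From mathcomp Require Import all_classical all_reals.
From mathcomp Require Import ereal topology normedtype sequences exp.
From mathcomp Require Import ring.
Import Order.TTheory GRing.Theory Num.Theory.
Import numFieldNormedType.Exports.

Set Implicit Arguments.
Unset Strict Implicit.
Unset Printing Implicit Defensive.

Local Open Scope ring_scope.
Local Open Scope quotient_scope.
Local Open Scope classical_set_scope.

(* |0| = 0 and |p ^ v * a / b| = p ^ - v for a, b prime to p.                 *)
Definition rat_padic_abs (p : nat) (x : rat) : rat :=
  if x == 0 then 0
  else p%:R ^ ((logn p `|denq x|%N)%:Z - (logn p `|numq x|%N)%:Z).

Section RatPadicAbs.
Variables (p : nat) (p_pr : prime p).
Local Notation abs := (rat_padic_abs p).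

Let p_gt0 : 0 < p%:R :> rat.
Proof. by rewrite ltr0n prime_gt0. Qed.

Lemma rat_padic_abs0 : abs 0 = 0.
Proof. by rewrite /rat_padic_abs eqxx. Qed.

Lemma rat_padic_abs_gt0 x : (0 < abs x) = (x != 0).
Proof.
by rewrite /rat_padic_abs; case: eqP => _; rewrite ?ltxx ?exprz_gt0.
Qed.

Lemma rat_padic_abs_ge0 x : 0 <= abs x.
Proof.
have [->|x0] := eqVneq x 0; first by rewrite rat_padic_abs0.
by rewrite ltW// rat_padic_abs_gt0.
Qed.

Lemma rat_padic_abs_eq0 x : (abs x == 0) = (x == 0).
Proof.
by apply/negb_inj; rewrite -(rat_padic_abs_gt0 x) lt0r rat_padic_abs_ge0 andbT.
Qed.

Lemma rat_padic_abs_div (a b : int) : a != 0 -> b != 0 ->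
  abs (a%:~R / b%:~R) = p%:R ^ ((logn p `|b|%N)%:Z - (logn p `|a|%N)%:Z).
Proof.
move=> a0 b0; set x := a%:~R / b%:~R.
have x0 : x != 0 by rewrite mulf_neq0 ?invr_eq0 ?intr_eq0.
rewrite /rat_padic_abs (negPf x0); congr (_ ^ _).
have e : a * denq x = numq x * b.
  apply: (@intr_inj rat); rewrite !intrM numqE /x mulrAC divfK ?intr_eq0//.
have := congr1 (fun z : int => logn p `|z|%N) e.
rewrite !abszM !lognM ?absz_gt0 ?denq_neq0 ?numq_eq0//.
move=> h; apply/eqP; rewrite subr_eq addrAC -subr_eq opprK -!PoszD eqz_nat.
by rewrite [X in X == _]addnC [X in _ == X]addnC h.
Qed.

Lemma rat_padic_absM x y : abs (x * y) = abs x * abs y.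
Proof.
have [->|x0] := eqVneq x 0; first by rewrite mul0r rat_padic_abs0 mul0r.
have [->|y0] := eqVneq y 0; first by rewrite mulr0 rat_padic_abs0 mulr0.
rewrite -[in LHS](divq_num_den x) -[in LHS](divq_num_den y) mulf_div -!intrM.
rewrite rat_padic_abs_div ?mulf_neq0 ?numq_eq0 ?denq_eq0//.
rewrite /rat_padic_abs (negPf x0) (negPf y0) -expfzDr ?gt_eqF//.
congr (_ ^ _); rewrite !abszM !lognM ?absz_gt0 ?numq_eq0 ?denq_neq0//.
by rewrite !PoszD opprD addrACA.
Qed.

Lemma rat_padic_abs1 : abs 1 = 1.
Proof. by rewrite /rat_padic_abs /= logn1 subrr expr0z. Qed.

Lemma rat_padic_absN x : abs (- x) = abs x.
Proof. by rewrite /rat_padic_abs oppr_eq0 numqN denqN abszN. Qed.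

Lemma rat_padic_absB x y : abs (x - y) = abs (y - x).
Proof. by rewrite -opprB rat_padic_absN. Qed.

Lemma rat_padic_absV x : abs x^-1 = (abs x)^-1.
Proof.
have [->|x0] := eqVneq x 0; first by rewrite !(invr0, rat_padic_abs0).
apply: (@mulfI _ (abs x)); first by rewrite rat_padic_abs_eq0.
by rewrite -rat_padic_absM !divff ?rat_padic_abs_eq0 ?rat_padic_abs1.
Qed.

Lemma rat_padic_absD x y : abs (x + y) <= Num.max (abs x) (abs y).
Proof.
have [->|x0] := eqVneq x 0; first by rewrite add0r le_max lexx orbT.
have [->|y0] := eqVneq y 0; first by rewrite addr0 le_max lexx.
have [->|xy0] := eqVneq (x + y) 0.
  by rewrite rat_padic_abs0 le_max rat_padic_abs_ge0.
have dx0 := denq_neq0 x; have dy0 := denq_neq0 y.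
set b := denq x * denq y; set A := numq x * denq y; set B := numq y * denq x.
have b0 : b != 0 by rewrite mulf_neq0.
have xE : x = A%:~R / b%:~R.
  apply: (@mulIf _ b%:~R); rewrite ?intr_eq0// divfK ?intr_eq0//.
  by rewrite /A /b !intrM numqE mulrA.
have yE : y = B%:~R / b%:~R.
  apply: (@mulIf _ b%:~R); rewrite ?intr_eq0// divfK ?intr_eq0//.
  by rewrite /B /b !intrM numqE mulrAC mulrA.
have A0 : A != 0 by rewrite mulf_neq0 ?numq_eq0.
have B0 : B != 0 by rewrite mulf_neq0 ?numq_eq0.
have sE : x + y = (A + B)%:~R / b%:~R by rewrite intrD mulrDl -xE -yE.
have AB0 : A + B != 0.
  by apply: contra_neq xy0 => AB0; rewrite sE AB0 mul0r.
have p_gt1 : 1 < p%:R :> rat by rewrite ltr1n prime_gt1.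
rewrite sE {1}xE {1}yE !rat_padic_abs_div// le_max !ler_eXz2l//.
rewrite !lerD2l !lerN2 !lez_nat.
have := leq_total (logn p `|A|%N) (logn p `|B|%N).
have le_logn k (C : int) : C != 0 ->
    (k <= logn p `|C|%N)%N = ((p ^ k)%:Z %| C)%Z.
  by move=> C0; rewrite dvdzE absz_nat pfactor_dvdn// absz_gt0.
case/orP => h; apply/orP; [left|right]; rewrite le_logn//.
- by rewrite rpredD -?le_logn.
- by rewrite rpredD -?le_logn.
Qed.

Lemma rat_padic_absD_lt x y e : abs x < e -> abs y < e -> abs (x + y) < e.
Proof.
by move=> xe ye; rewrite (le_lt_trans (rat_padic_absD _ _))// gt_max xe.
Qed.

Lemma rat_padic_absD_eq x y : abs y < abs x -> abs (x + y) = abs x.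
Proof.
move=> yx; apply/eqP; rewrite eq_le; apply/andP; split.
  by rewrite (le_trans (rat_padic_absD _ _))// ge_max lexx ltW.
rewrite leNgt; apply/negP => h.
have : abs (x + y - y) < abs x by rewrite rat_padic_absD_lt// rat_padic_absN.
by rewrite addrK ltxx.
Qed.

End RatPadicAbs.

Section PadicCauchy.
Variables (p : nat) (p_pr : prime p).
Local Notation abs := (rat_padic_abs p).

Definition padic_cauchy (_ : prime p) : {pred nat -> rat} := fun u =>
  `[< forall e : rat, 0 < e -> exists N, forall i j, (N <= i)%N -> (N <= j)%N ->
        abs (u i - u j) < e >].

Lemma padic_cauchyP u : reflect
  (forall e : rat, 0 < e -> exists N, forall i j, (N <= i)%N -> (N <= j)%N ->
     abs (u i - u j) < e) (u \in padic_cauchy p_pr).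
Proof. exact: asboolP. Qed.

Lemma padic_cauchy_bounded u : u \in padic_cauchy p_pr ->
  exists M, exists N, 0 < M /\ forall i, (N <= i)%N -> abs (u i) < M.
Proof.
move=> /padic_cauchyP/(_ 1 ltr01)[N uN]; exists (1 + abs (u N)), N.
have M0 : 0 < 1 + abs (u N) by rewrite ltr_wpDr// rat_padic_abs_ge0.
split=> // i Ni; rewrite -(subrK (u N) (u i)) rat_padic_absD_lt//.
  by rewrite (lt_le_trans (uN _ _ Ni (leqnn _)))// lerDl rat_padic_abs_ge0.
by rewrite ltrDr.
Qed.

Lemma padic_cauchy_subring : subring_closed (padic_cauchy p_pr).
Proof.
split=> [|u v /padic_cauchyP uC /padic_cauchyP vC|u v uC vC].
- by apply/padic_cauchyP => e e0; exists 0%N => i j _ _;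
    rewrite subrr rat_padic_abs0.
- apply/padic_cauchyP => e e0.
  have [N uN] := uC _ e0; have [M vM] := vC _ e0.
  exists (maxn N M) => i j; rewrite !geq_max => /andP[Ni Mi] /andP[Nj Mj].
  rewrite !fctE (_ : _ - _ = (u i - u j) - (v i - v j)); last by ring.
  by rewrite rat_padic_absD_lt// ?rat_padic_absN ?uN ?vM.
have [B [N0 [B0 uB]]] := padic_cauchy_bounded uC.
have [C [M0 [C0 vB]]] := padic_cauchy_bounded vC.
move: uC vC => /padic_cauchyP uC /padic_cauchyP vC.
apply/padic_cauchyP => e e0.
have [N uN] := uC _ (divr_gt0 e0 C0); have [M vM] := vC _ (divr_gt0 e0 B0).
exists (maxn (maxn N0 M0) (maxn N M)) => i j.
rewrite !geq_max => /andP[/andP[N0i M0i] /andP[Ni Mi]].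
move=> /andP[/andP[N0j M0j] /andP[Nj Mj]]; rewrite !fctE.
rewrite (_ : _ - _ = (u i - u j) * v i + (v i - v j) * u j); last by ring.
apply: rat_padic_absD_lt => //; rewrite rat_padic_absM//.
  by rewrite -(divfK (lt0r_neq0 C0) e) ltr_pM ?rat_padic_abs_ge0 ?uN ?vB.
by rewrite -(divfK (lt0r_neq0 B0) e) ltr_pM ?rat_padic_abs_ge0 ?vM ?uB.
Qed.

HB.instance Definition _ := GRing.isSubringClosed.Build (nat -> rat)
  (padic_cauchy p_pr) padic_cauchy_subring.

Record padic_seq := PadicSeq {
  padic_seq_val :> nat -> rat;
  _ : padic_seq_val \in padic_cauchy p_pr }.

HB.instance Definition _ := [isSub for padic_seq_val].
HB.instance Definition _ := [Choice of padic_seq by <:].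
HB.instance Definition _ :=
  [SubChoice_isSubComNzRing of padic_seq by <:].

Definition padic_null : {pred padic_seq} := fun u =>
  `[< forall e : rat, 0 < e -> exists N, forall i, (N <= i)%N ->
        abs (u i) < e >].

Lemma padic_nullP (u : padic_seq) : reflect
  (forall e : rat, 0 < e -> exists N, forall i, (N <= i)%N -> abs (u i) < e)
  (u \in padic_null).
Proof. exact: asboolP. Qed.

Lemma padic_null_ideal : idealr_closed padic_null.
Proof.
split=> [||u v w /padic_nullP v0 /padic_nullP w0].
- by apply/padic_nullP => e e0; exists 0%N => i _ /=; rewrite rat_padic_abs0.
- apply/padic_nullP => /(_ 1 ltr01)[N /(_ N (leqnn N))] /=.
  by rewrite rat_padic_abs1 ltxx.
have [B [N0 [B0 uB]]] := padic_cauchy_bounded (valP u).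
apply/padic_nullP => e e0.
have [N vN] := v0 _ (divr_gt0 e0 B0); have [M wM] := w0 _ e0.
exists (maxn N0 (maxn N M)) => i; rewrite !geq_max => /and3P[N0i Ni Mi] /=.
rewrite rat_padic_absD_lt ?wM// rat_padic_absM// mulrC.
by rewrite -(divfK (lt0r_neq0 B0) e) ltr_pM ?rat_padic_abs_ge0 ?vN ?uB.
Qed.

HB.instance Definition _ :=
  isIdealr.Build padic_seq padic_null padic_null_ideal.

(* The completion of rat for rat_padic_abs: Cauchy sequences modulo null ones. *)
Definition Qp : Type := {ideal_quot padic_null}.
HB.instance Definition _ := GRing.ComNzRing.on Qp.
HB.instance Definition _ := EqQuotient.on Qp.

(* A Cauchy sequence that is not null has eventually constant absolute value. *)
Lemma padic_abs_evconst (u : padic_seq) : u \notin padic_null ->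
  exists c, exists N, 0 < c /\ forall i, (N <= i)%N -> abs (u i) = c.
Proof.
move=> /padic_nullP/existsNP[e /not_implyP[e0 /forallNP uN]].
have /padic_cauchyP/(_ e e0)[N uC] := valP u.
have /existsNP[i /not_implyP[Ni /negP]] := uN N.
rewrite -leNgt => ui.
exists (abs (u i)), N; split=> [|j Nj]; first exact: lt_le_trans ui.
rewrite -(subrK (u i) (u j)) addrC rat_padic_absD_eq//.
exact: lt_le_trans (uC _ _ Nj Ni) ui.
Qed.

Lemma padic_cauchyV (u : padic_seq) : u \notin padic_null ->
  (fun n => (u n)^-1) \in padic_cauchy p_pr.
Proof.
move=> /padic_abs_evconst[c [N [c0 uN]]].
apply/padic_cauchyP => e e0.
have /padic_cauchyP/(_ (e * c ^+ 2))[|M uM] := valP u.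
  by rewrite mulr_gt0// exprn_gt0.
exists (maxn N M) => i j; rewrite !geq_max => /andP[Ni Mi] /andP[Nj Mj].
have ui0 : u i != 0 by rewrite -(rat_padic_abs_gt0 p_pr) uN.
have uj0 : u j != 0 by rewrite -(rat_padic_abs_gt0 p_pr) uN.
rewrite (_ : _ - _ = (u j - u i) / (u i * u j)); last by field; apply/andP.
rewrite rat_padic_absM// rat_padic_absV// rat_padic_absM// !uN//.
by rewrite ltr_pdivrMr ?mulr_gt0// -expr2; apply: uM.
Qed.

(* The class of the inverses of the terms of a representative of x.           *)
Definition Qp_inv (x : Qp) : Qp :=
  if x == 0 then 0
  else \pi_Qp (insubd (0 : padic_seq) (fun n => (repr x n)^-1)).

Lemma Qp_pi_eq0 (u : padic_seq) : (\pi_Qp u == 0) = (u \in padic_null).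
Proof.
by rewrite -[X in _ == X](rmorph0 \pi_Qp) -Quotient.idealrBE subr0.
Qed.

Lemma Qp_repr_eq0 (x : Qp) : (repr x \in padic_null) = (x == 0).
Proof. by rewrite -Qp_pi_eq0 reprK. Qed.

Lemma Qp_mulVf (x : Qp) : x != 0 -> Qp_inv x * x = 1.
Proof.
move=> x0; rewrite /Qp_inv (negPf x0) -{2}(reprK x) -rmorphM.
have un : repr x \notin padic_null by rewrite Qp_repr_eq0.
have [c [N [c0 uN]]] := padic_abs_evconst un.
apply/eqP; rewrite -subr_eq0 -(rmorph1 \pi_Qp) -rmorphB Qp_pi_eq0.
apply/padic_nullP => e e0; exists N => i Ni /=.
rewrite insubdK ?padic_cauchyV// !fctE mulVf ?subrr ?rat_padic_abs0//.
by rewrite -(rat_padic_abs_gt0 p_pr) uN.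
Qed.

Lemma Qp_inv0 : Qp_inv 0 = 0.
Proof. by rewrite /Qp_inv eqxx. Qed.

HB.instance Definition _ := GRing.ComNzRing_isField.Build Qp Qp_mulVf Qp_inv0.

End PadicCauchy.

Arguments padic_null {p} p_pr u.

Section QpAbs.
Variables (R : realType) (p : nat) (p_pr : prime p).
Local Notation abs := (rat_padic_abs p).
Local Notation Qp := (Qp p_pr).
Local Notation padic_seq := (padic_seq p_pr).

(* lim |u_k|_p for a representative u of x; by Qp_abs_cvg the limit exists and   *)
(* does not depend on the choice of u.                                        *)
Definition Qp_abs (x : Qp) : R :=
  limn (fun k => ratr (rat_padic_abs p (repr x k)) : R).

Lemma padic_null_cvg (u : padic_seq) : u \in padic_null p_pr ->
  (ratr (abs (u k)) : R) @[k --> \oo] --> (0 : R).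
Proof.
move=> /padic_nullP u0; apply/cvgr0Pnorm_lt => e e0.
have /rat_in_itvoo[q /itvP qe] : 0 < e by [].
have q0 : 0 < q by rewrite -(@ltr_rat R) rmorph0 qe.
have [N uN] := u0 _ q0; exists N => // k /= Nk.
rewrite ger0_norm ?ler0q ?rat_padic_abs_ge0//.
by rewrite (lt_trans _ (_ : ratr q < _)) ?qe// ltr_rat uN.
Qed.

Lemma padic_abs_cvg (u : padic_seq) :
  cvgn (fun k => ratr (abs (u k)) : R).
Proof.
have [un|/padic_abs_evconst[c [N [c0 uN]]]] := boolP (u \in padic_null p_pr).
  exact: cvgP (padic_null_cvg un).
apply: (@cvgP _ _ (ratr c : R)); apply: cvg_near_cst.
by exists N => // k /= Nk; rewrite uN.
Qed.

Lemma Qp_abs_cvg (u : padic_seq) :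
  (ratr (abs (u k)) : R) @[k --> \oo] --> Qp_abs (\pi_Qp u).
Proof.
rewrite /Qp_abs; set v := repr _.
have uv : u - v \in padic_null p_pr by rewrite Quotient.idealrBE reprK.
have [un|un] := boolP (u \in padic_null p_pr).
  have vn : v \in padic_null p_pr by rewrite -(subKr u v) rpredB.
  by rewrite (cvg_lim _ (padic_null_cvg vn))//; exact: padic_null_cvg.
have [c [N [c0 uN]]] := padic_abs_evconst un.
have /padic_nullP/(_ c c0)[M uvM] := uv.
rewrite [X in _ --> X](_ : _ = ratr c).
  by apply: cvg_near_cst; exists N => // k /= Nk; rewrite uN.
apply: cvg_lim => //; apply: cvg_near_cst.
exists (maxn N M) => // k /=; rewrite geq_max => /andP[Nk Mk]; congr ratr.
rewrite -(uN _ Nk) -[in LHS](subrK (u k) (v k)) addrC rat_padic_absD_eq//.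
by rewrite rat_padic_absB uN// uvM.
Qed.

Arguments Qp_abs_cvg u : clear implicits.

Lemma Qp_abs_ge0 (x : Qp) : 0 <= Qp_abs x.
Proof.
apply: limr_ge; first exact: padic_abs_cvg.
by near=> k; rewrite ler0q rat_padic_abs_ge0.
Unshelve. all: by end_near. Qed.

Lemma Qp_absE (u : padic_seq) (l : R) :
  (ratr (abs (u k)) : R) @[k --> \oo] --> l -> Qp_abs (\pi_Qp u) = l.
Proof.
by move=> ul; exact: (norm_cvg_unique (Qp_abs_cvg u) ul).
Qed.

Lemma Qp_absM (x y : Qp) : Qp_abs (x * y) = Qp_abs x * Qp_abs y.
Proof.
rewrite -(reprK x) -(reprK y) -rmorphM; apply: Qp_absE.
under eq_fun do rewrite rat_padic_absM// rmorphM/=.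
exact: cvgM (Qp_abs_cvg _) (Qp_abs_cvg _).
Qed.

Lemma Qp_absD (x y : Qp) : Qp_abs (x + y) <= Num.max (Qp_abs x) (Qp_abs y).
Proof.
rewrite -(reprK x) -(reprK y) -rmorphD maxr_absE.
set u := repr x; set v := repr y.
have ucvg := Qp_abs_cvg u; have vcvg := Qp_abs_cvg v.
pose m k : R := (ratr (abs (u k)) + ratr (abs (v k)) +
  `|ratr (abs (u k)) - ratr (abs (v k))|) / 2.
have mcvg : m @ \oo --> (Qp_abs (\pi_Qp u) + Qp_abs (\pi_Qp v) +
    `|Qp_abs (\pi_Qp u) - Qp_abs (\pi_Qp v)|) / 2.
  by apply: cvgMr_tmp; apply: cvgD; [exact: cvgD|apply: cvg_norm; exact: cvgB].
apply: ler_cvg_to (Qp_abs_cvg (u + v)) mcvg _.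
near=> k; rewrite /m -maxr_absE.
by have := rat_padic_absD p_pr (u k) (v k); rewrite !le_max !ler_rat.
Unshelve. all: by end_near. Qed.

Lemma Qp_abs_eq0 (x : Qp) : (Qp_abs x == 0) = (x == 0).
Proof.
rewrite -[in RHS]Qp_repr_eq0 -{1}(reprK x); set u := repr x.
have [un|un] := boolP (u \in padic_null p_pr).
  by apply/eqP/Qp_absE; exact: padic_null_cvg.
have [c [N [c0 uN]]] := padic_abs_evconst un.
rewrite (@Qp_absE _ (ratr c)) ?fmorph_eq0 ?gt_eqF//.
by apply: cvg_near_cst; exists N => // k /= Nk; rewrite uN.
Qed.

Lemma padic_seq_cst_subproof (q : rat) :
  (fun=> q) \in padic_cauchy p_pr.
Proof.
by apply/padic_cauchyP => e e0; exists 0%N => i j _ _;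
  rewrite subrr rat_padic_abs0.
Qed.

Definition Qp_of_rat (q : rat) : Qp :=
  \pi_Qp (PadicSeq (padic_seq_cst_subproof q)).

Lemma Qp_of_rat_is_zmod_morphism : zmod_morphism Qp_of_rat.
Proof.
by move=> a b; rewrite /Qp_of_rat -[RHS]rmorphB; apply: congr1; exact: val_inj.
Qed.

Lemma Qp_of_rat_is_monoid_morphism : monoid_morphism Qp_of_rat.
Proof.
split=> [|a b]; rewrite /Qp_of_rat.
  by rewrite -[RHS](rmorph1 \pi_Qp); apply: congr1; exact: val_inj.
by rewrite -[RHS]rmorphM; apply: congr1; exact: val_inj.
Qed.

HB.instance Definition _ := GRing.isZmodMorphism.Build rat Qp Qp_of_rat
  Qp_of_rat_is_zmod_morphism.
HB.instance Definition _ := GRing.isMonoidMorphism.Build rat Qp Qp_of_rat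
  Qp_of_rat_is_monoid_morphism.

Lemma Qp_of_ratE (q : rat) : Qp_of_rat q = ratr q.
Proof. exact: fmorph_eq_rat. Qed.

Lemma Qp_abs_ratr (q : rat) : Qp_abs (ratr q) = ratr (rat_padic_abs p q).
Proof.
by rewrite -Qp_of_ratE; apply: Qp_absE; apply: cvg_near_cst; exists 0%N.
Qed.

Lemma Qp_absN (x : Qp) : Qp_abs (- x) = Qp_abs x.
Proof.
rewrite -(reprK x) -rmorphN; apply: Qp_absE.
by under eq_fun do rewrite rat_padic_absN; exact: Qp_abs_cvg.
Qed.

Lemma Qp_rat_approx (u : padic_seq) (e : rat) : 0 < e -> exists N,
  forall k, (N <= k)%N -> Qp_abs (\pi_Qp u - ratr (u k)) <= ratr e.
Proof.
move=> e0; have /padic_cauchyP/(_ e e0)[N uN] := valP u.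
exists N => k Nk; rewrite -Qp_of_ratE -rmorphB.
have h := Qp_abs_cvg (u - PadicSeq (padic_seq_cst_subproof (u k))).
rewrite -(cvg_lim _ h)//; apply: limr_le; first exact: padic_abs_cvg.
by exists N => // i /= Ni; rewrite ler_rat ltW// uN.
Qed.

Lemma Qp_rat_dense (x : Qp) (e : R) : 0 < e ->
  exists q, Qp_abs (x - ratr q) < e.
Proof.
move=> /rat_in_itvoo[d /itvP de].
have d0 : 0 < d by rewrite -(@ltr_rat R) rmorph0 de.
have [N uN] := Qp_rat_approx (repr x) d0; exists (repr x N).
rewrite -[in X in X - _](reprK x); apply: le_lt_trans (uN _ (leqnn N)) _.
by rewrite de.
Qed.

Lemma Qp_complete (x : nat -> Qp) :
  (forall e : R, 0 < e -> exists N, forall i j, (N <= i)%N -> (N <= j)%N ->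
     Qp_abs (x i - x j) < e) ->
  exists y, forall e : R, 0 < e -> exists N, forall i, (N <= i)%N ->
     Qp_abs (x i - y) < e.
Proof.
move=> xC.
have /choice[q qx] k : exists q, Qp_abs (x k - ratr q) < k.+1%:R^-1.
  by apply: Qp_rat_dense; rewrite invr_gt0.
have small (e : R) : 0 < e -> exists N, forall k, (N <= k)%N ->
    Qp_abs (x k - ratr (q k)) < e.
  move=> e0; have [N _ Ne] : \forall k \near \oo, k.+1%:R^-1 < e :> R.
    exact: near_infty_natSinv_lt (PosNum e0).
  by exists N => k Nk; rewrite (lt_trans (qx k)) ?Ne.
have tri a b c (e : R) : Qp_abs (a - b) < e -> Qp_abs (b - c) < e ->
    Qp_abs (a - c) < e.
  move=> ab bc; rewrite -(subrKA b) (le_lt_trans (Qp_absD _ _))//.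
  by rewrite gt_max ab.
have sym a b : Qp_abs (a - b) = Qp_abs (b - a) by rewrite -opprB Qp_absN.
have qC : q \in padic_cauchy p_pr.
  apply/padic_cauchyP => e e0; have e0' : 0 < ratr e :> R by rewrite ltr0q.
  have [N xN] := xC _ e0'; have [M qM] := small _ e0'.
  exists (maxn N M) => i j; rewrite !geq_max => /andP[Ni Mi] /andP[Nj Mj].
  rewrite -(@ltr_rat R) -Qp_abs_ratr -Qp_of_ratE.
  rewrite (rmorphB Qp_of_rat) /= !Qp_of_ratE.
  apply: (tri _ (x i)); first by rewrite sym qM.
  by apply: (tri _ (x j)); [exact: xN|exact: qM].
exists (\pi_Qp (PadicSeq qC)) => e e0.
have /rat_in_itvoo[d /itvP de] := e0.
have d0 : 0 < d by rewrite -(@ltr_rat R) rmorph0 de.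
have [N qN] := Qp_rat_approx (PadicSeq qC) d0; have [M qM] := small _ e0.
exists (maxn N M) => i; rewrite geq_max => /andP[Ni Mi].
apply: (tri _ (ratr (q i))); first exact: qM.
by rewrite sym (le_lt_trans (qN _ Ni))// de.
Qed.

End QpAbs.

Arguments Qp_abs R {p p_pr} x.

Section UniformExponents.
Variables (R : realType) (p : nat) (p_pr : prime p) (n : nat) (xi : Qp p_pr).

Definition w_hat_admissible (w : R) : Prop :=
  \forall X \near (+oo : set_system R), exists x : 'I_n.+1 -> int,
    (\max_(i < n.+1) `|x i|)%N%:R <= X /\
    0 < Qp_abs R (\sum_(i < n.+1) (x i)%:~R * xi ^+ i) <= X `^ (- w - 1).

Definition w_hat : \bar R := ereal_sup [set w%:E | w in w_hat_admissible].

(* The maximum over 1 <= m <= n is taken in R with default value 0, which is  *)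
(* harmless since absolute values are nonnegative.                            *)
Definition lambda_hat_admissible (l : R) : Prop :=
  \forall X \near (+oo : set_system R), exists x : 'I_n.+1 -> int,
    (\max_(i < n.+1) `|x i|)%N%:R <= X /\
    0 < \big[Num.max/0]_(m < n.+1 | (0 < m)%N)
          Qp_abs R ((x ord0)%:~R * xi ^+ m - (x m)%:~R) <= X `^ (- l - 1).

Definition lambda_hat : \bar R :=
  ereal_sup [set l%:E | l in lambda_hat_admissible].

End UniformExponents.

Arguments w_hat R {p p_pr} n xi.
Arguments lambda_hat R {p p_pr} n xi.

(* Main.v *)
Require Import Defs.
From mathcomp Require Import all_boot all_order all_algebra.
From mathcomp Require Import all_classical all_reals.
From mathcomp Require Import ereal topology normedtype sequences exp.
From mathcomp Require Import perm qpoly zify ring lra.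
Import Order.TTheory GRing.Theory Num.Theory.
Import numFieldNormedType.Exports.

(** Both bounds rest on one construction: for arbitrarily large Y, two coprime
    integer polynomials P and Q of degree at most n and height at most Y with
    |P(xi)|_p and |Q(xi)|_p at most Y^(- v').  It is available as soon as, for
    some v > v' and all large X, there is a nonzero integer polynomial of degree
    at most n and height at most X whose value at xi is O(X^(- v))
    ([coprime_approximants]).

    The first polynomial P is irreducible and satisfies
    |P(xi)|_p <= height(P)^(- v').  Such P of large height exist because heights
    are multiplicative up to a constant ([height_mul_le]): if all irreducible
    polynomials but those of bounded height violated the inequality, then so
    would, up to a constant factor, every product of irreducible polynomials
    ([irreducible_lower_bound]), against the hypothesis with exponent v > v'.
    The second polynomial Q comes from the hypothesis at X = c height(P), where
    c is so small that no nonzero multiple of P has height at most X; as P is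
    irreducible, Q is then coprime to P.

    For w_hat, let v = w + 1.  The resultant of P and Q is a nonzero integer of
    size O(Y^(2n)), and being an integral combination of P and Q it has p-adic
    absolute value O(Y^(- v')).  A nonzero integer k satisfies |k|_p >= 1/|k|,
    so v' <= 2n for every v' < v, that is w + 1 <= 2n.

    For lambda_hat, let m be the upper half of n.  By the pigeonhole principle
    every xi satisfies the hypothesis of the construction in degree m with
    v = m + 1 ([dirichlet]).  If lambda > 1/m, choose s with 1/lambda < s < m, put
    X = Y^s and take a simultaneous approximation x = (x_0, ..., x_n) of size at
    most X.  The integer <F, x> = sum_i F_i x_i has size O(Y X) when F has height
    at most Y, and it is p-adically close to x_0 F(xi); for F = 'X^j P and
    F = 'X^j Q with j < m it is therefore too small p-adically to be nonzero.
    Since 2m <= n + 1, an expression u P + v Q of the resultant pairs to zero with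
    x, so Res(P, Q) x_0 = 0 and x_0 = 0.  Then |x_i|_p <= X^(- lambda - 1) < 1/X
    forces all x_i to vanish, which the definition of lambda_hat excludes. *)

Set Implicit Arguments.
Unset Strict Implicit.
Unset Printing Implicit Defensive.

Local Open Scope ring_scope.

(** * Heights of integer polynomials *)

Definition height (P : {poly int}) : nat := \max_(i < size P) `|(P`_i)%R|%N.

Lemma coef_le_height (P : {poly int}) i : (`|(P`_i)%R| <= height P)%N.
Proof.
have [iP|Pi] := ltnP i (size P); last by rewrite nth_default.
exact: (leq_bigmax (Ordinal iP)).
Qed.

Lemma height_leP (P : {poly int}) M :
  reflect (forall i, (`|(P`_i)%R| <= M)%N) (height P <= M)%N.
Proof.
apply: (iffP idP) => [PM i|PM]; first exact: leq_trans (coef_le_height P i) PM.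
by apply/bigmax_leqP => i _; exact: PM.
Qed.

Lemma height_gt0 P : (0 < height P)%N = (P != 0).
Proof.
apply/idP/idP => [|P0].
  by apply: contraTneq => ->; rewrite /height size_poly0 big_ord0.
apply: leq_trans (coef_le_height P (size P).-1).
by rewrite absz_gt0 -lead_coefE lead_coef_eq0.
Qed.

Lemma heightZ (c : int) (P : {poly int}) :
  height (c *: P) = (`|c| * height P)%N.
Proof.
have [->|c0] := eqVneq c 0.
  by rewrite scale0r mul0n /height size_poly0 big_ord0.
rewrite /height size_scale//.
elim/big_rec2: _ => [|i x y _ ->]; first by rewrite muln0.
by rewrite coefZ abszM maxnMr.
Qed.

(** Dividing out one point, A = ('X - a) q + A(a), where q has integer
    coefficients and |q(b)| <= |A(b)| + |A(a)| at every other integer point b, so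
    the bound follows by induction on the points without inverting a Vandermonde
    matrix.  The factor D allows hypotheses of the form |A(a)| <= M / D to be
    stated in the natural numbers. *)
Lemma height_interpolation (N D : nat) (s : seq nat) (A : {poly int}) (M : nat) :
  uniq s -> all (fun a => a <= N)%N s -> (size A <= size s)%N ->
  {in s, forall a : nat, (`|A.[a%:Z]%R| * D <= M)%N} ->
  (height A * D <= (2 * N.+2) ^ size s * M)%N.
Proof.
elim: s A M => [|a s IH] A M /=.
  rewrite leqn0 size_poly_eq0 => _ _ /eqP-> _.
  by rewrite /height size_poly0 big_ord0.
move=> /andP[aNs us] /andP[aN sN] sA AM.
have /factor_theorem[q qE] : root (A - A.[a%:Z]%:P) a%:Z.
  by rewrite /root hornerD hornerN hornerC subrr.
have sq : (size q <= size s)%N.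
  have [->|q0] := eqVneq q 0; first by rewrite size_poly0.
  have : (size (q * ('X - (a%:Z)%:P))%R <= (size s).+1)%N.
    rewrite -qE (leq_trans (size_polyD _ _))// geq_max sA size_polyN.
    by rewrite (leq_trans (size_polyC_leq1 _)).
  by rewrite size_Mmonic ?monicXsubC// size_XsubC addn2 ltnS.
have AMa : (`|A.[a%:Z]%R| * D <= M)%N by apply: AM; rewrite mem_head.
have qM : {in s, forall b : nat, (`|q.[b%:Z]%R| * D <= 2 * M)%N}.
  move=> b bs; have AMb : (`|A.[b%:Z]%R| * D <= M)%N.
    by apply: AM; rewrite inE bs orbT.
  have ba : b != a by apply: contraNneq aNs => <-.
  have /(congr1 (fun P : {poly int} => P.[b%:Z])) := qE.
  rewrite hornerM hornerXsubC hornerD hornerN hornerC => e.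
  have -> : (2 * M = M + M)%N by lia.
  apply: leq_trans (leq_add AMb AMa).
  rewrite -mulnDl leq_mul2r; apply/orP; right.
  have : (`|q.[b%:Z]%R| * 1 <= `|q.[b%:Z]%R| * `|(b%:Z - a%:Z)%R|)%N.
    by rewrite leq_mul2l; apply/orP; right; lia.
  by rewrite -abszM -e muln1 => /leq_trans; apply; lia.
have := IH q _ us sN sq qM; set K := (_ ^ size s)%N => qK.
have K0 : (0 < K)%N by rewrite expn_gt0.
have AE : A = q * 'X - a%:Z *: q + A.[a%:Z]%:P.
  rewrite -[LHS](subrK A.[a%:Z]%:P) qE mulrBr.
  by rewrite -[q * (a%:Z)%:P]mulrC mul_polyC.
have hA : (height A <= height q + N * height q + `|A.[a%:Z]%R|)%N.
  apply/height_leP => i; rewrite {1}AE !coefD coefN coefMX coefZ coefC.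
  have h1 := coef_le_height q i; have h2 := coef_le_height q i.-1.
  have h3 : (`|(a%:Z * q`_i)%R| <= N * height q)%N by rewrite abszM leq_mul.
  by case: ifP; lia.
apply: leq_trans (leq_mul hA (leqnn D)) _.
rewrite expnS -/K.
have NqK : (N * (height q * D) <= N * (K * (2 * M)))%N by rewrite leq_mul.
have MK : (M <= K * M)%N by rewrite leq_pmull.
by clear -qK AMa NqK MK; lia.
Qed.

Lemma absz_sum (I : Type) (r : seq I) (P : pred I) (F : I -> int) :
  (`|(\sum_(i <- r | P i) F i)%R| <= \sum_(i <- r | P i) `|F i|)%N.
Proof. elim/big_rec2: _ => // i x y _; lia. Qed.

Lemma horner_height (N : nat) (A : {poly int}) (a : nat) :
  (0 < N)%N -> (a <= N)%N ->
  (`|A.[a%:Z]%R| <= size A * N ^ size A * height A)%N.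
Proof.
move=> N0 aN; rewrite horner_coef.
apply: leq_trans (absz_sum _ _ _) _.
apply: leq_trans (_ : \sum_(i < size A) N ^ size A * height A <= _)%N.
  apply: leq_sum => i _; rewrite abszM abszX mulnC leq_mul ?coef_le_height//.
  apply: leq_trans (leq_pexp2l N0 (ltnW (ltn_ord i))).
  by case: (nat_of_ord i) => [|k]; rewrite ?expn0 ?leq_exp2r.
by rewrite sum_nat_const card_ord mulnA.
Qed.

(** The square of the interpolation constant at the 2n + 1 points 0, ..., 2n,
    times the constant of [horner_height] for a product of degree at most 2n. *)
Definition gelfond_cst n :=
  (((2 * n.*2.+2) ^ n.*2.+1) ^ 2 * (n.*2.+1 * n.*2.+1 ^ n.*2.+1))%N.

(** Gelfond's inequality.  By interpolation a nonzero polynomial of degree at most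
    n is small compared with its height at no more than n of the points
    0, ..., 2n; at one of these 2n + 1 points both A and B are therefore large,
    and so is their product. *)
Lemma height_mul_le n (A B : {poly int}) :
  (size A <= n.+1)%N -> (size B <= n.+1)%N ->
  (height A * height B <= gelfond_cst n * height (A * B)%R)%N.
Proof.
move=> sA sB.
have [->|A0] := eqVneq A 0; first by rewrite /height size_poly0 big_ord0.
have [->|B0] := eqVneq B 0; first by rewrite {2}/height size_poly0 big_ord0 muln0.
pose K := ((2 * n.*2.+2) ^ n.*2.+1)%N.
pose s := iota 0 n.*2.+1.
pose bad (P : {poly int}) := fun a : nat => (`|P.[a%:Z]%R| * K < height P)%N.
have few_bad (P : {poly int}) : P != 0 -> (size P <= n.+1)%N ->
    (count (bad P) s <= n)%N.
  move=> P0 sP; rewrite leqNgt -size_filter; apply/negP => nbad.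
  (* n + 1 bad points would give height P <= height P - 1 *)
  have : (height P * K <=
      (2 * n.*2.+2) ^ size (seq.filter (bad P) s) * (height P).-1)%N.
    apply: height_interpolation; first by rewrite filter_uniq ?iota_uniq.
    - by apply/allP => a; rewrite mem_filter mem_iota => /andP[_]; lia.
    - exact: leq_trans nbad.
    - by move=> a; rewrite mem_filter => /andP[]; rewrite /bad; lia.
  have h : ((2 * n.*2.+2) ^ size (seq.filter (bad P) s) <= K)%N.
    by rewrite leq_pexp2l// -[leqRHS](size_iota 0) size_filter count_size.
  have K0 : (0 < K)%N by rewrite expn_gt0.
  have := P0; rewrite -height_gt0; move: h; set L := (_ ^ _)%N => h hP.
  by move=> /leq_trans/(_ (leq_mul h (leqnn _))); nia.
have /allPn[a as_ good] : ~~ all (predU (bad A) (bad B)) s.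
  rewrite all_count size_iota; apply: contraTN isT => /eqP e.
  have := count_predUI (bad A) (bad B) s; rewrite e.
  by have := few_bad _ A0 sA; have := few_bad _ B0 sB; lia.
move: good; rewrite /= negb_or -!leqNgt => /andP[gA gB].
apply: leq_trans (leq_mul gA gB) _.
have aN : (a <= n.*2.+1)%N by move: as_; rewrite mem_iota; lia.
have := @horner_height _ (A * B)%R _ (ltn0Sn _) aN.
have sAB : (size (A * B)%R <= n.*2.+1)%N.
  by have := size_polyMleq A B; move: sA sB; move: (size _) => x; lia.
rewrite hornerM abszM => h.
rewrite /gelfond_cst -/K mulnACA -mulnn [leqLHS]mulnC -[leqRHS]mulnA.
rewrite leq_mul2l; apply/orP; right.
by apply: leq_trans h _; rewrite !leq_mul ?leq_pexp2l.
Qed.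

Lemma gelfond_cst_gt0 n : (0 < gelfond_cst n)%N.
Proof. by rewrite /gelfond_cst !muln_gt0 !expn_gt0. Qed.

Lemma resultant_height n (A B : {poly int}) (Y : nat) : (0 < Y)%N ->
  (size A <= n.+1)%N -> (size B <= n.+1)%N ->
  (height A <= Y)%N -> (height B <= Y)%N ->
  (`|resultant A B| <= (n.*2)`! * Y ^ n.*2)%N.
Proof.
move=> Y0 sA sB hA hB; rewrite /resultant.
set N := ((size B).-1 + (size A).-1)%N.
have Nn : (N <= n.*2)%N by rewrite /N; lia.
apply: leq_trans (_ : N`! * Y ^ N <= _)%N; last first.
  by rewrite leq_mul ?leq_pexp2l ?leq_fact.
apply: leq_trans (absz_sum _ _ _) _.
apply: leq_trans (_ : \sum_(s : 'S_N) Y ^ N <= _)%N; last first.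
  by rewrite sum_nat_const -card_Sn.
apply: leq_sum => s _; rewrite abszMsign.
rewrite -[in leqRHS](card_ord N) -prod_nat_const.
rewrite (big_morph absz abszM (erefl _)); apply: leq_prod => i _.
rewrite Sylvester_mxE /=.
by case: (fintype.split i) => k; case: (k <= _)%N => //;
  apply: leq_trans (coef_le_height _ _) _.
Qed.

(** * Real powers *)

Section real_powers.
Variable R : realType.
Implicit Types (a b v e C : R).

Lemma powRN_le a b v : 0 < a -> a <= b -> 0 <= v -> b `^ (- v) <= a `^ (- v).
Proof.
move=> a0 ab v0; have b0 := lt_le_trans a0 ab.
rewrite !powRN lef_pV2 ?posrE ?powR_gt0//.
by rewrite ge0_ler_powR ?nnegrE ?(ltW a0) ?(ltW b0).
Qed.

Lemma powRN_le1 a v : 1 <= a -> 0 <= v -> a `^ (- v) <= 1.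
Proof. by move=> a1 v0; have := powRN_le ltr01 a1 v0; rewrite powR1. Qed.

Lemma powRN_leV a v : 1 <= a -> 1 <= v -> a `^ (- v) <= a^-1.
Proof.
move=> a1 v1; rewrite -powR_inv1 ?(le_trans ler01)//.
by rewrite ler_powR// lerN2.
Qed.

Lemma powRN_ltV a v : 1 < a -> 1 < v -> a `^ (- v) < a^-1.
Proof.
move=> a1 v1; have a0 := lt_trans ltr01 a1.
rewrite powRN ltf_pV2 ?posrE ?powR_gt0//.
rewrite -mulr_powRB1 ?(ltW a0) ?(lt_trans ltr01)//.
have -> : a < a * a `^ (v - 1) = (1 `^ (v - 1) < a `^ (v - 1)).
  by rewrite powR1 ltr_pMr.
by rewrite gt0_ltr_powR ?nnegrE ?subr_gt0 ?(ltW a0).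
Qed.

Lemma near_lt_powR e C : 0 < e ->
  \forall X \near (+oo : set_system R), C < X `^ e.
Proof.
move=> e0; pose D := Num.max 1 C.
have D0 : 0 < D by rewrite lt_max ltr01.
near=> X; apply: le_lt_trans (_ : D < _); first by rewrite le_max lexx orbT.
have XD : D `^ e^-1 < X by near: X; exact: nbhs_pinfty_gt.
rewrite -[D]powRr1 ?ltW// -[Y in _ `^ Y](mulVf (lt0r_neq0 e0)) powRrM.
by apply: gt0_ltr_powR; rewrite // nnegrE ?powR_ge0// (le_trans _ (ltW XD)).
Unshelve. all: by end_near. Qed.

End real_powers.

(** * The p-adic absolute value *)

Section Qp_abs_theory.
Variables (R : realType) (p : nat) (p_pr : prime p).
Local Notation Qp := (Qp p_pr).
Local Notation abs := (Qp_abs R : Qp -> R).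

Lemma Qp_abs1 : abs 1 = 1.
Proof.
by rewrite -[1]/(1%:~R) -ratr_int Qp_abs_ratr rat_padic_abs1 rmorph1.
Qed.

Lemma Qp_abs0 : abs 0 = 0.
Proof. by apply/eqP; rewrite Qp_abs_eq0. Qed.

Lemma Qp_absX (x : Qp) k : abs (x ^+ k) = abs x ^+ k.
Proof. by elim: k => [|k IH]; rewrite ?expr0 ?Qp_abs1// !exprS Qp_absM IH. Qed.

Lemma Qp_absB_le (x y : Qp) (e : R) :
  abs x <= e -> abs y <= e -> abs (x - y) <= e.
Proof.
by move=> xe ye; rewrite (le_trans (Qp_absD R _ _))// ge_max xe Qp_absN.
Qed.

Lemma Qp_abs_sum_le (I : Type) (r : seq I) (P : pred I) (F : I -> Qp) (e : R) :
  0 <= e -> (forall i, P i -> abs (F i) <= e) ->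
  abs (\sum_(i <- r | P i) F i) <= e.
Proof.
move=> e0 Fe; elim/big_ind: _ => //.
  by rewrite Qp_abs0.
by move=> x y xe ye; rewrite (le_trans (Qp_absD R _ _))// ge_max xe.
Qed.

Lemma rat_padic_abs_int (k : int) : k != 0 ->
  rat_padic_abs p k%:~R = p%:R ^- logn p `|k|%N.
Proof.
move=> k0; have := rat_padic_abs_div p k0 (oner_neq0 _).
by rewrite mulr1z divr1 => ->; rewrite /= logn1 sub0r -exprnN.
Qed.

Lemma Qp_abs_intr (k : int) : abs k%:~R = ratr (rat_padic_abs p k%:~R).
Proof. by rewrite -Qp_abs_ratr ratr_int. Qed.

Lemma Qp_abs_dvd (k : int) M : (p%:Z ^+ M %| k)%Z -> abs k%:~R <= p%:R ^- M.
Proof.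
have p0 : 0 < p%:R :> R by rewrite ltr0n prime_gt0.
have [-> _|k0 Mk] := eqVneq k 0.
  by rewrite Qp_abs0 invr_ge0 exprn_ge0// ltW.
rewrite Qp_abs_intr rat_padic_abs_int// fmorphV/= rmorphXn/= ratr_nat.
rewrite lef_pV2 ?posrE ?exprn_gt0// ler_eXn2l ?ltr1n ?prime_gt1//.
by rewrite -pfactor_dvdn ?absz_gt0//; move: Mk; rewrite dvdzE abszX.
Qed.

Lemma Qp_abs_int_le1 (k : int) : abs k%:~R <= 1.
Proof. by have := @Qp_abs_dvd k 0 (dvd1z k); rewrite expr0 invr1. Qed.

Lemma Qp_abs_int_ge (k : int) : k != 0 -> `|k|%N%:R^-1 <= abs k%:~R.
Proof.
move=> k0; have p0 : 0 < p%:R :> R by rewrite ltr0n prime_gt0.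
rewrite Qp_abs_intr rat_padic_abs_int// fmorphV/= rmorphXn/= ratr_nat.
rewrite lef_pV2 ?posrE ?exprn_gt0 ?ltr0n ?absz_gt0 ?prime_gt0// -natrX ler_nat.
by rewrite dvdn_leq ?absz_gt0// pfactor_dvdnn.
Qed.

(** The denominator of a rational approximation of a p-adic integer is prime to p,
    hence invertible modulo p^M. *)
Lemma Zp_approx (x : Qp) M : abs x <= 1 ->
  exists c : int, abs (x - c%:~R) <= p%:R ^- M.
Proof.
move=> x1; have p0 : 0 < p%:R :> R by rewrite ltr0n prime_gt0.
have e0 : 0 < p%:R ^- M :> R by rewrite invr_gt0 exprn_gt0.
have e1 : p%:R ^- M <= 1 :> R.
  by rewrite invf_le1 ?exprn_gt0// exprn_ege1// ler1n prime_gt0.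
have [q xq] := Qp_rat_dense x e0.
have q1 : abs (ratr q) <= 1.
  by rewrite -(subKr x (ratr q)) Qp_absB_le// (le_trans (ltW xq)).
have [q0|q0] := eqVneq q 0.
  by exists 0; move: xq; rewrite q0 -Qp_of_ratE rmorph0 => /ltW.
have cop : coprime (p ^ M) `|denq q|.
  rewrite coprimeXl// prime_coprime//; apply/negP => pd.
  have : (logn p `|denq q| <= logn p `|numq q|)%N.
    have : rat_padic_abs p q <= 1.
      by rewrite -(ler_rat R) rmorph1 -(Qp_abs_ratr R p_pr).
    rewrite /rat_padic_abs (negPf q0).
    by rewrite -(expr0z p%:R) ler_eXz2l ?ltr1n ?prime_gt1//; lia.
  have d0 : (0 < `|denq q|)%N by rewrite absz_gt0.
  have n0 : (0 < `|numq q|)%N by rewrite absz_gt0 numq_eq0.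
  have : (0 < logn p `|denq q|)%N by rewrite logn_gt0 mem_primes p_pr d0.
  move=> /leq_trans h /h; rewrite logn_gt0 mem_primes => /and3P[_ _ pn].
  have := coprime_num_den q; rewrite /coprime => /eqP g.
  have : (p %| 1)%N by rewrite -g dvdn_gcd pn.
  by rewrite dvdn1 => /eqP p1; move: p_pr; rewrite p1.
have /coprimezP[[u v] /= uv] : coprimez (p ^ M)%N%:Z (denq q).
  by rewrite /coprimez /gcdz.
exists (numq q * v).
rewrite -(subrK (ratr q) x) -addrA.
have -> : ratr q - (numq q * v)%:~R = ratr q * (u * p%:Z ^+ M)%:~R :> Qp.
  have -> : u * p%:Z ^+ M = 1 - v * denq q.
    by rewrite -uv addrK -[(p ^ M)%N%:Z]natz natrX natz.
  rewrite intrB intrM intrM mulrBr mulr1; congr (_ - _).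
  have -> : (numq q)%:~R = ratr q * (denq q)%:~R :> Qp.
    by rewrite -[LHS]ratr_int numqE -!Qp_of_ratE rmorphM/= !Qp_of_ratE ratr_int.
  by rewrite mulrAC mulrA.
rewrite (le_trans (Qp_absD R _ _))// ge_max (ltW xq)/= Qp_absM.
rewrite -[leRHS]mul1r.
apply: ler_pM => //; [exact: Qp_abs_ge0|exact: Qp_abs_ge0|].
exact/Qp_abs_dvd/dvdz_mull.
Qed.

End Qp_abs_theory.

(** * Values of integer polynomials at a p-adic number *)

Section value_at_xi.
Variables (R : realType) (p : nat) (p_pr : prime p) (xi : Qp p_pr).
Local Notation Qp := (Qp p_pr).
Local Notation abs := (Qp_abs R : Qp -> R).

Definition abs_at (P : {poly int}) : R := abs (map_poly intr P).[xi].

Lemma horner_map_intr n (P : {poly int}) : (size P <= n)%N ->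
  (map_poly intr P).[xi] = \sum_(i < n) (P`_i)%:~R * xi ^+ i :> Qp.
Proof.
move=> Pn; rewrite (@horner_coef_wide _ n) ?(leq_trans (size_poly _ _))//.
by apply: eq_bigr => i _; rewrite coef_map.
Qed.

Lemma abs_at_sum n (P : {poly int}) : (size P <= n)%N ->
  abs_at P = abs (\sum_(i < n) (P`_i)%:~R * xi ^+ i).
Proof. by move=> Pn; rewrite /abs_at (horner_map_intr Pn). Qed.

Lemma abs_at0 : abs_at 0 = 0.
Proof. by rewrite /abs_at rmorph0 horner0 Qp_abs0. Qed.

Lemma abs_at_ge0 (P : {poly int}) : 0 <= abs_at P. Proof. exact: Qp_abs_ge0. Qed.

Lemma abs_atM (P Q : {poly int}) : abs_at (P * Q) = abs_at P * abs_at Q.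
Proof. by rewrite /abs_at rmorphM hornerM Qp_absM. Qed.

Lemma abs_atC (c : int) : abs_at c%:P = abs c%:~R.
Proof. by rewrite /abs_at map_polyC hornerC. Qed.

Lemma abs_atXn (P : {poly int}) k : abs_at ('X^k * P) = abs xi ^+ k * abs_at P.
Proof. by rewrite abs_atM {1}/abs_at map_polyXn hornerXn Qp_absX. Qed.

Lemma abs_atD_le (P Q : {poly int}) e :
  abs_at P <= e -> abs_at Q <= e -> abs_at (P + Q) <= e.
Proof.
move=> Pe Qe; rewrite /abs_at rmorphD hornerD.
by rewrite (le_trans (Qp_absD R _ _))// ge_max Pe.
Qed.

Definition xi_size : R := Num.max 1 (abs xi).

Lemma xi_size_ge1 : 1 <= xi_size. Proof. by rewrite le_max lexx. Qed.

Lemma xi_powers_le n i : (i <= n)%N -> abs xi ^+ i <= xi_size ^+ n.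
Proof.
move=> i_n; apply: le_trans (_ : xi_size ^+ i <= _).
  rewrite lerXn2r ?nnegrE ?Qp_abs_ge0 ?(le_trans ler01 xi_size_ge1)//.
  by rewrite le_max lexx orbT.
by rewrite ler_weXn2l ?xi_size_ge1.
Qed.

Lemma abs_at_le n (P : {poly int}) : (size P <= n.+1)%N ->
  abs_at P <= xi_size ^+ n.
Proof.
move=> Pn; rewrite /abs_at (horner_map_intr Pn).
apply: Qp_abs_sum_le => [|i _].
  by rewrite exprn_ge0// (le_trans ler01 xi_size_ge1).
rewrite Qp_absM Qp_absX -[leRHS]mul1r.
rewrite ler_pM ?exprn_ge0 ?Qp_abs_ge0 ?Qp_abs_int_le1//.
by rewrite xi_powers_le// -ltnS.
Qed.

(** The pigeonhole principle: scale the powers of xi into the p-adic integers,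
    reduce them modulo p^M, and compare the values modulo p^M of the polynomials
    with coefficients in 0, ..., x; there are more than p^M such polynomials, so
    the difference of two of them has a value divisible by p^M up to the scaling. *)
Lemma dirichlet m : exists2 C : R, 0 < C & forall X : R, 1 <= X ->
  exists P : {poly int}, [/\ P != 0, (size P <= m.+1)%N, (height P)%:R <= X &
    abs_at P <= C * X `^ - m.+1%:R].
Proof.
have p_gt1 := prime_gt1 p_pr.
have p0 : 0 < p%:R :> R by rewrite ltr0n prime_gt0.
have [K Kxi] : exists K, xi_size ^+ m <= p%:R ^+ K.
  exists (Num.trunc (xi_size ^+ m)).+1.
  apply: le_trans (ltW (truncnS_gt _)) _; rewrite -natrX ler_nat.
  by rewrite ltnW// ltn_expl.
pose y i : Qp := p%:R ^+ K * xi ^+ i.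
have absp : abs p%:R = p%:R^-1.
  rewrite pmulrn Qp_abs_intr rat_padic_abs_int; last first.
    by rewrite eqz_nat -lt0n ltnW.
  by rewrite absz_nat -[X in logn _ X]expn1 pfactorK// expr1 fmorphV/= ratr_nat.
have y1 i : (i < m.+1)%N -> abs (y i) <= 1.
  move=> im; rewrite Qp_absM !Qp_absX absp exprVn ler_pdivrMl ?exprn_gt0//.
  by rewrite mulr1 (le_trans _ Kxi)// xi_powers_le.
exists (p%:R ^+ K.+1); first by rewrite exprn_gt0.
move=> X X1; pose x := Num.trunc X.
have x1 : (0 < x)%N by rewrite truncn_gt0.
have xX : x%:R <= X by rewrite truncn_le (le_trans ler01).
have Xx : X < x.+1%:R by rewrite truncnS_gt.
(* the largest M for which the polynomials outnumber the residues mod p^M *)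
pose M := trunc_log p (x.+1 ^ m.+1).-1.
have x2 : (1 < x.+1 ^ m.+1)%N by rewrite -(exp1n m.+1) ltn_exp2r.
have ML : (p ^ M < x.+1 ^ m.+1)%N.
  by rewrite -[ltnRHS]prednK ?ltnS ?trunc_logP// ?ltn_predRL// ltnW.
have MU : (x.+1 ^ m.+1 <= p ^ M.+1)%N.
  by have := trunc_log_ltn (x.+1 ^ m.+1).-1 p_gt1; rewrite prednK// ltnW.
have /choice[c cP] (i : 'I_m.+1) : exists c : int, abs (y i - c%:~R) <= p%:R ^- M.
  by apply: Zp_approx; exact: y1.
pose comb (g : {ffun 'I_m.+1 -> 'I_x.+1}) : int := \sum_i (g i)%:Z * c i.
have pM0 : (0 < p ^ M)%N by rewrite expn_gt0 ltnW.
have pM_neq0 : (p ^ M)%N%:Z != 0 by rewrite eqz_nat -lt0n.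
have modlt g : (`|(comb g %% (p ^ M)%N%:Z)%Z|%N < p ^ M)%N.
  by rewrite -ltz_nat gez0_abs ?modz_ge0 ?ltz_pmod.
pose f g := Ordinal (modlt g).
have /injectivePn[g [h gh fgh]] : ~~ injectiveb f.
  apply/negP => /injectiveP/leq_card.
  by rewrite card_ffun !card_ord leqNgt => /negP; exact.
pose P := \poly_(i < m.+1) ((g (inord i))%:Z - (h (inord i))%:Z).
have sP : (size P <= m.+1)%N by exact: size_poly.
have PE (i : 'I_m.+1) : P`_i = (g i)%:Z - (h i)%:Z.
  by rewrite coef_poly ltn_ord inord_val.
have e0 : 0 <= p%:R ^- M :> R by rewrite invr_ge0 exprn_ge0// ltW.
exists P; split => //.
- apply: contra_neq gh => P0; apply/ffunP => i; apply/val_inj => /=.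
  by have := PE i; rewrite P0 coef0 => /esym/eqP; rewrite subr_eq0 => /eqP[].
- apply: le_trans xX; rewrite ler_nat; apply/height_leP => i.
  rewrite coef_poly; case: ifP => // _.
  move: (ltn_ord (g (inord i))) (ltn_ord (h (inord i))).
  by move: (nat_of_ord _) (nat_of_ord _) => a b; lia.
have dvd : ((p%:Z ^+ M) %| \sum_(i < m.+1) P`_i * c i)%Z.
  have -> : \sum_(i < m.+1) P`_i * c i = comb g - comb h.
    by rewrite -sumrB; apply: eq_bigr => i _; rewrite PE mulrBl.
  have -> : p%:Z ^+ M = (p ^ M)%N%:Z by rewrite -[RHS]natz natrX natz.
  rewrite -eqz_mod_dvd; apply/eqP.
  rewrite -[LHS]gez0_abs ?modz_ge0// -[RHS]gez0_abs ?modz_ge0//.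
  by case: fgh => ->.
have : p%:R ^- K * abs_at P <= p%:R ^- M.
  have -> : p%:R ^- K * abs_at P = abs (\sum_(i < m.+1) (P`_i)%:~R * y i).
    rewrite -exprVn -absp -Qp_absX /abs_at -Qp_absM (horner_map_intr sP) mulr_sumr.
    by congr abs; apply: eq_bigr => i _; rewrite /y mulrCA.
  have -> : \sum_(i < m.+1) (P`_i)%:~R * y i =
      (\sum_(i < m.+1) P`_i * c i)%:~R -
      \sum_(i < m.+1) (P`_i)%:~R * ((c i)%:~R - y i).
    rewrite rmorph_sum -sumrB; apply: eq_bigr => i _.
    by rewrite rmorphM mulrBr opprB addrCA subrr addr0.
  apply: Qp_absB_le; first exact: Qp_abs_dvd.
  apply: Qp_abs_sum_le => // i _; rewrite Qp_absM -[leRHS]mul1r.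
  apply: ler_pM; [exact: Qp_abs_ge0|exact: Qp_abs_ge0|exact: Qp_abs_int_le1|].
  by rewrite -Qp_absN opprB.
rewrite ler_pdivrMl ?exprn_gt0// => /le_trans; apply.
rewrite exprSr -mulrA ler_pM2l ?exprn_gt0// powR_invn ?(le_trans ler01)//.
rewrite ler_pdivlMr ?exprn_gt0 ?(lt_le_trans ltr01)// ler_pdivrMl ?exprn_gt0//.
rewrite -exprSr; apply: le_trans (_ : x.+1%:R ^+ m.+1 <= _).
  by rewrite lerXn2r ?nnegrE ?ler0n ?(ltW Xx)// (le_trans ler01).
by rewrite -!natrX ler_nat.
Qed.

End value_at_xi.

Arguments abs_at R {p p_pr} xi P.
Arguments xi_size R {p p_pr} xi.


(** * Coprime pairs of good approximations *)

Section irreducible_approximants.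
Variables (R : realType) (p : nat) (p_pr : prime p) (xi : Qp p_pr).
Hypothesis xi_transc : ~ algebraicOver (ratr : rat -> Qp p_pr) xi.
Local Notation abs_at := (abs_at R xi).

Lemma abs_at_gt0 (P : {poly int}) : P != 0 -> 0 < abs_at P.
Proof.
move=> P0; rewrite lt_neqAle abs_at_ge0 andbT eq_sym Qp_abs_eq0.
apply/negP => Pxi; apply: xi_transc; exists (map_poly intr P).
  by rewrite map_poly_eq0_id0 ?intr_eq0 ?lead_coef_eq0.
rewrite /root -map_poly_comp_id0; last exact: (ratr_int _ 0).
by rewrite (eq_map_poly (fun z => ratr_int _ z)).
Qed.

(** There are finitely many such polynomials, and by transcendence none of them
    vanishes at xi. *)
Lemma abs_at_bounded_height n B : exists2 d : R, 0 < d &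
  forall P : {poly int}, P != 0 -> (size P <= n)%N -> (height P <= B)%N ->
    d <= abs_at P.
Proof.
pose T := {ffun 'I_n -> 'I_B.*2.+1}.
pose coef (t : T) (i : nat) : int :=
  if insub i is Some i' then (t i')%:Z - B%:Z else 0.
pose poly_of (t : T) : {poly int} := \poly_(i < n) coef t i.
exists (\big[Num.min/1]_(t : T | poly_of t != 0) abs_at (poly_of t)).
  by apply: lt_bigmin => // t; exact: abs_at_gt0.
move=> P P0 sP hP.
pose t : T := [ffun i : 'I_n => inord `|(P`_i + B%:Z)%R|%N].
have tP : poly_of t = P.
  apply/polyP => i; rewrite coef_poly; case: ltnP => [i_n|n_i].
    rewrite /coef insubT ffunE /=.
    have := leq_trans (coef_le_height P i) hP => PB.
    by move: P`_i PB => c cB; rewrite inordK; lia.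
  by rewrite nth_default// (leq_trans sP).
by rewrite -[in leRHS]tP; apply: bigmin_le_cond; rewrite tP.
Qed.

(** Both sides are multiplicative up to constants: the left one by Gelfond's
    inequality, the right one exactly.  A nonzero integer c satisfies
    |c|_p >= 1/|c| >= |c|^(- v) as 1 <= v, so contents can be divided out, and the
    induction on the degree reduces to the irreducible primitive case. *)
Lemma irreducible_lower_bound n (v d0 : R) : 1 <= v -> 0 < d0 ->
  (forall Q : {poly int}, irreducible_poly Q -> zprimitive Q = Q ->
     (size Q <= n.+1)%N -> d0 * (height Q)%:R `^ (- v) <= abs_at Q) ->
  forall s, (s <= n.+1)%N -> exists2 d : R, 0 < d &
    forall P : {poly int}, P != 0 -> (size P <= s)%N ->
      d * (height P)%:R `^ (- v) <= abs_at P.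
Proof.
move=> v1 d0_gt0 irr; have v0 : 0 <= v := le_trans ler01 v1.
have pw_ge0 (P : {poly int}) : 0 <= (height P)%:R `^ (- v) :> R.
  exact: powR_ge0.
have const (c : int) : c != 0 ->
    `|c|%N%:R `^ (- v) <= Qp_abs R (c%:~R : Qp p_pr).
  move=> c0; apply: le_trans (Qp_abs_int_ge R p_pr c0); apply: powRN_leV => //.
  by rewrite ler1n absz_gt0.
elim=> [|s IH] sn.
  by exists 1 => // P; rewrite leqn0 size_poly_eq0 => /negPf->.
have [d d_gt0 dP] := IH (ltnW sn).
pose K : R := (gelfond_cst n)%:R.
have K_gt0 : 0 < K by rewrite ltr0n gelfond_cst_gt0.
pose dd := Num.min (Num.min 1 d0) (d ^+ 2 * K `^ (- v)).
have dd_gt0 : 0 < dd.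
  by rewrite !lt_min ltr01 d0_gt0 mulr_gt0 ?exprn_gt0 ?powR_gt0.
exists dd => // P P0 sP.
have weaken (Q : {poly int}) e : dd <= e ->
    e * (height Q)%:R `^ (- v) <= abs_at Q ->
    dd * (height Q)%:R `^ (- v) <= abs_at Q.
  by move=> de; apply: le_trans; rewrite ler_wpM2r.
suff prim (Q : {poly int}) : Q != 0 -> (size Q <= s.+1)%N -> zprimitive Q = Q ->
    dd * (height Q)%:R `^ (- v) <= abs_at Q.
  have c0 : zcontents P != 0 by rewrite zcontents_eq0.
  rewrite [P]zpolyEprim heightZ natrM powRM// -mul_polyC abs_atM abs_atC mulrCA.
  apply: ler_pM => //.
  - by rewrite mulr_ge0// ltW.
  - exact: const.
  by apply: prim; rewrite ?zprimitive_eq0 ?size_zprimitive ?zprimitive_id.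
move=> {P P0 sP} Q0 sQ primQ.
have [sQ1|sQ1] := leqP (size Q) 1.
  apply: (@weaken _ 1); first by rewrite !ge_min lexx.
  have QE := size1_polyC sQ1; have c0 : Q`_0 != 0.
    by apply: contra_neq Q0 => Q00; rewrite QE Q00.
  rewrite mul1r QE abs_atC; apply: le_trans (const _ c0).
  by apply: powRN_le; rewrite ?ltr0n ?absz_gt0// ler_nat -QE coef_le_height.
have [irrQ|/existsNP[A /not_implyP[sA /not_implyP[AQ AnQ]]]] :=
    pselect (forall A : {poly int}, size A != 1%N -> A %| Q -> A %= Q).
  apply: (@weaken _ d0); first by rewrite !ge_min lexx !orbT.
  by apply: irr => //; apply: leq_trans sn.
have [B QE] := dvdpP_int AQ.
have AB0 : zprimitive A * B != 0 by rewrite -QE.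
have [A0 B0] : zprimitive A != 0 /\ B != 0.
  by move: AB0; rewrite mulf_eq0 negb_or => /andP[].
have sAQ : (size A < size Q)%N.
  rewrite ltn_neqAle dvdp_leq// andbT; apply/negP => /eqP sAQ.
  by apply: AnQ; rewrite -dvdp_size_eqp// sAQ.
have sQE : (size Q).+1 = (size A + size B)%N.
  rewrite QE size_mul// size_zprimitive prednK// addn_gt0.
  by rewrite [X in _ || X]size_poly_gt0 B0 orbT.
have sA_gt0 : (0 < size A)%N by rewrite size_poly_gt0 -(zprimitive_eq0 A).
have sB : (size B <= s)%N.
  rewrite -ltnS (leq_trans _ sQ)// -ltnS sQE -[ltnLHS]add1n ltn_add2r.
  by rewrite ltn_neqAle eq_sym sA.
have sA' : (size A <= s)%N by rewrite -ltnS (leq_trans sAQ).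
apply: (@weaken _ (d ^+ 2 * K `^ (- v))); first by rewrite ge_min lexx orbT.
have sAz : (size (zprimitive A) <= s)%N by rewrite size_zprimitive.
have g := height_mul_le (leq_trans sAz (ltnW sn)) (leq_trans sB (ltnW sn)).
rewrite QE abs_atM; apply: le_trans (ler_pM _ _ (dP _ A0 sAz) (dP _ B0 sB)).
- rewrite mulrACA -expr2 -mulrA ler_pM2l ?exprn_gt0// -!powRM//.
  apply: powRN_le => //; last by rewrite -!natrM ler_nat.
  by rewrite -natrM ltr0n muln_gt0 !height_gt0 A0.
- by rewrite mulr_ge0// ltW.
- by rewrite mulr_ge0// ltW.
Qed.

Definition uniformly_approximable n (v C : R) : Prop :=
  \forall X \near (+oo : set_system R), exists P : {poly int},
    [/\ P != 0, (size P <= n.+1)%N, (height P)%:R <= X &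
      abs_at P <= C * X `^ (- v)].

(** Otherwise |Q(xi)|_p >= d height(Q)^(- v') for all irreducible primitive Q
    of degree at most n, the finitely many ones of small height being absorbed in
    d; by [irreducible_lower_bound] the same then holds, with another d, for all
    nonzero Q of degree at most n, which contradicts uniform approximability with
    the larger exponent v. *)
Lemma irreducible_approximant n (v v' C : R) (G : R -> Prop) :
  1 <= v' -> v' < v -> uniformly_approximable n v C ->
  (\forall X \near (+oo : set_system R), G X) ->
  exists Q : {poly int}, [/\ irreducible_poly Q, zprimitive Q = Q,
    (size Q <= n.+1)%N, abs_at Q <= (height Q)%:R `^ (- v') & G (height Q)%:R].
Proof.
move=> v'1 v'v unif [M [_ GM]]; have v'0 := le_trans ler01 v'1.
apply: contrapT => noQ.
have [d1 d1_gt0 d1P] := abs_at_bounded_height n.+1 (Num.trunc M).+1.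
have low (Q : {poly int}) : irreducible_poly Q -> zprimitive Q = Q ->
    (size Q <= n.+1)%N -> Num.min 1 d1 * (height Q)%:R `^ (- v') <= abs_at Q.
  move=> irrQ primQ sQ; have Q0 := irredp_neq0 irrQ.
  have hQ : 1 <= (height Q)%:R :> R by rewrite ler1n height_gt0.
  have [hB|hB] := leqP (height Q) (Num.trunc M).+1.
    apply: le_trans (d1P _ Q0 sQ hB).
    rewrite -[leRHS]mulr1 ler_pM ?powR_ge0 ?powRN_le1//.
      by rewrite le_min ler01 ltW.
    by rewrite ge_min lexx orbT.
  have MQ : M < (height Q)%:R by rewrite (lt_trans (truncnS_gt _))// ltr_nat.
  have [small|/ltW big] := leP (abs_at Q) ((height Q)%:R `^ (- v')).
    by exfalso; apply: noQ; exists Q; split => //; exact: GM.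
  by apply: le_trans big; rewrite ler_piMl ?powR_ge0// ge_min lexx.
have min_gt0 : 0 < Num.min 1 d1 by rewrite lt_min ltr01.
have [d d_gt0 dP] := irreducible_lower_bound v'1 min_gt0 low (leqnn n.+1).
have vv'0 : 0 < v - v' by rewrite subr_gt0.
have big := near_lt_powR (C / d) vv'0.
have [X [[P [P0 sP hP vP]] X_big]] :
    exists X : R, (exists P : {poly int}, [/\ P != 0, (size P <= n.+1)%N,
       (height P)%:R <= X & abs_at P <= C * X `^ (- v)]) /\ C / d < X `^ (v - v').
  exact: filter_ex (filterI unif big).
have hP0 : 0 < (height P)%:R :> R by rewrite ltr0n height_gt0.
have X0 := lt_le_trans hP0 hP.
have : d * X `^ (- v') <= C * X `^ (- v).
  apply: le_trans vP; apply: le_trans (dP _ P0 sP).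
  by rewrite ler_pM2l// powRN_le.
rewrite leNgt => /negP; apply.
rewrite [X in _ * X < _]powRN ltr_pdivrMr ?powR_gt0// -mulrA.
rewrite -powRD; last by rewrite lt0r_neq0// implybT.
by rewrite addrC -ltr_pdivrMl// mulrC.
Qed.

(** The property G, true near infinity, lets the caller make Y as large as it
    needs.  P is an irreducible approximation with Y = height P, and Q is an
    approximation of height so much smaller that, by Gelfond's inequality, it
    cannot be a multiple of P. *)
Lemma coprime_approximants n (v v' C : R) (G : R -> Prop) :
  1 < v' -> v' < v -> uniformly_approximable n v C ->
  (\forall X \near (+oo : set_system R), G X) ->
  exists Y : nat, G Y%:R /\ exists P Q : {poly int}, coprimep P Q /\
    forall F, F \in [:: P; Q] ->
      [/\ (1 < size F)%N, (size F <= n.+1)%N, (height F <= Y)%N &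
        abs_at F <= Y%:R `^ (- v')].
Proof.
move=> v'1 v'v unif GX.
pose K : R := 2 * (gelfond_cst n)%:R.
have K_gt0 : 0 < K by rewrite mulr_gt0// ltr0n gelfond_cst_gt0.
have [X0 [_ approx]] := unif.
have vv'0 : 0 < v - v' by rewrite subr_gt0.
have [] := @irreducible_approximant n v v' C
    (fun Y => [/\ G Y, 1 < Y, X0 * K < Y &
      C * K `^ v < Y `^ (v - v')]) (ltW v'1) v'v unif.
  near=> Y; split; near: Y; [exact: GX| | |exact: near_lt_powR].
  - exact/nbhs_pinfty_gt/num_real.
  - exact/nbhs_pinfty_gt/num_real.
move=> P [irrP primP sP vP [GY Y1 YX0 Ybig]]; exists (height P); split => //.
have Y0 := lt_trans ltr01 Y1; have P0 := irredp_neq0 irrP.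
have [|Q [Q0 sQ hQ vQ]] := approx ((height P)%:R / K).
  by rewrite ltr_pdivlMr.
have hQP : (gelfond_cst n * height Q < height P)%N.
  rewrite -(ltr_nat R) natrM; move: hQ; rewrite ler_pdivlMr// /K => hQ.
  have : 0 < (gelfond_cst n)%:R * (height Q)%:R :> R.
    by rewrite -natrM ltr0n muln_gt0 gelfond_cst_gt0 height_gt0.
  by move: hQ; lra.
have vQ' : abs_at Q <= (height P)%:R `^ (- v').
  apply: le_trans vQ _.
  have -> : ((height P)%:R / K) `^ (- v) = K `^ v * (height P)%:R `^ (- v).
    rewrite powRM ?invr_ge0 ?ltW// -[in K^-1]powR_inv1 ?ltW// -powRrM.
    by rewrite mulN1r opprK mulrC.
  have -> : - v' = (v - v') - v by ring.
  rewrite [leRHS]powRD; last by rewrite (lt0r_neq0 Y0) implybT.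
  by rewrite mulrA ler_wpM2r ?powR_ge0// ltW.
exists P, Q; split.
  rewrite irreducible_poly_coprime//; apply/negP => /dvdpP_int[A QE].
  rewrite primP in QE.
  have A0 : A != 0 by apply: contra_neq Q0 => A0; rewrite QE A0 mulr0.
  have sA : (size A <= n.+1)%N.
    by rewrite (leq_trans _ sQ)// dvdp_leq// QE dvdp_mull.
  have := height_mul_le sP sA; rewrite -QE => h.
  have h2 : (height P * 1 <= height P * height A)%N.
    by rewrite leq_mul2l height_gt0 A0 orbT.
  by move: (leq_trans h2 h); rewrite muln1 leqNgt hQP.
have hQ' : (height Q <= height P)%N.
  by apply: leq_trans (ltnW hQP); rewrite leq_pmull// gelfond_cst_gt0.
move=> F; rewrite !inE => /orP[]/eqP->; split => //; first by case: irrP.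
(* a constant Q would have |Q|_p >= 1/|Q| >= 1/Y > Y^(- v') *)
rewrite ltnNge; apply/negP => sQ1.
have QE := size1_polyC sQ1; have c0 : Q`_0 != 0.
  by apply: contra_neq Q0 => Q00; rewrite QE Q00.
move: vQ'; rewrite QE abs_atC => /(le_trans (Qp_abs_int_ge R p_pr c0)).
rewrite leNgt => /negP; apply.
apply: (@lt_le_trans _ _ ((height P)%:R^-1)).
  exact: powRN_ltV.
rewrite lef_pV2 ?posrE ?ltr0n ?absz_gt0 ?height_gt0// ler_nat.
by rewrite (leq_trans _ hQ')// coef_le_height.
Unshelve. all: by end_near. Qed.

End irreducible_approximants.

(** * The uniform exponents *)

Lemma ceil_half (R : realType) n : Num.ceil (n%:R / 2 : R) = (uphalf n)%:Z.
Proof.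
apply: ceil_def; apply/andP; split.
  have : n%:R <= (2 * uphalf n)%:R :> R by rewrite ler_nat; lia.
  have : ((2 * uphalf n)%:R : R) <= n.+1%:R by rewrite ler_nat; lia.
  rewrite !natrM -natr1 rmorphB/= => a b; rewrite ltr_pdivlMr//; lra.
have : n%:R <= (2 * uphalf n)%:R :> R by rewrite ler_nat; lia.
by rewrite ler_pdivrMr// natrM; lra.
Qed.

Section exponents.
Variables (R : realType) (p : nat) (p_pr : prime p) (xi : Qp p_pr).
Hypothesis xi_transc : ~ algebraicOver (ratr : rat -> Qp p_pr) xi.
Local Notation abs_at := (abs_at R xi).

Lemma w_admissible_approximable n (w : R) : w_hat_admissible n xi w ->
  uniformly_approximable xi n (w + 1) (1 : R).
Proof.
apply: filterS => X [x [xX /andP[x0 xw]]].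
pose P := \poly_(i < n.+1) x (inord i).
have sP : (size P <= n.+1)%N by exact: size_poly.
have PE : abs_at P = Qp_abs R (\sum_(i < n.+1) (x i)%:~R * xi ^+ i).
  rewrite (abs_at_sum R xi sP); congr Qp_abs; apply: eq_bigr => i _.
  by rewrite coef_poly ltn_ord inord_val.
exists P; split => //.
- by apply: contraTneq x0 => P0; rewrite -PE P0 abs_at0 ltxx.
- apply: le_trans xX; rewrite ler_nat; apply/height_leP => i.
  by rewrite coef_poly; case: ifP => // _; exact: (leq_bigmax (inord i)).
- by rewrite PE mul1r opprD.
Qed.

(** The resultant of two coprime approximations is too small p-adically for a
    nonzero integer of its size. *)
Lemma w_admissible_le n (w : R) : (0 < n)%N ->
  w_hat_admissible n xi w -> w <= 2 * n%:R - 1.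
Proof.
move=> n_gt0 /w_admissible_approximable approx.
rewrite leNgt; apply/negP => w_big.
have n1 : 1 <= n%:R :> R by rewrite ler1n.
pose v := w + 1; pose v' := (v + 2 * n%:R) / 2.
have v'2n : 0 < v' - (n.*2)%:R by rewrite /v' /v -muln2 natrM; lra.
have v'1 : 1 < v' by rewrite /v' /v; lra.
have v'v : v' < v by rewrite /v' /v; lra.
pose D : R := (n.*2)`!%:R * xi_size R xi ^+ n.
have [Y [[Y1 YD] [P [Q [cop PQ]]]]] :=
  @coprime_approximants R p p_pr xi xi_transc n v v' 1
  (fun Y => 1 < Y /\ D < Y `^ (v' - (n.*2)%:R)) v'1 v'v approx
  (filterI (nbhs_pinfty_gt (num_real 1)) (near_lt_powR D v'2n)).
have [sP1 sP hP vP] := PQ P (mem_head _ _).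
have [|sQ1 sQ hQ vQ] := PQ Q; first by rewrite !inE eqxx orbT.
have [[u1 u2] /= [su1 su2] res] := resultant_in_ideal sP1 sQ1.
have r0 : resultant P Q != 0.
  by rewrite resultant_eq0 -leqNgt; move: cop; rewrite coprimep_def => /eqP->.
have Y0 : (0 < Y)%N by rewrite -(ltr0n R) (lt_trans ltr01).
have rle := resultant_height Y0 sP sQ hP hQ.
have rabs : abs_at (resultant P Q)%:P <= xi_size R xi ^+ n * Y%:R `^ (- v').
  rewrite res; apply: abs_atD_le;
    rewrite abs_atM ler_pM ?abs_at_ge0 ?abs_at_le//.
    by rewrite ltnW// (leq_trans su1).
  by rewrite ltnW// (leq_trans su2).
rewrite abs_atC in rabs; have := le_trans (Qp_abs_int_ge R p_pr r0) rabs.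
have : ((n.*2)`! * Y ^ n.*2)%:R^-1 <= `|resultant P Q|%N%:R^-1 :> R.
  rewrite lef_pV2 ?posrE ?ltr0n ?absz_gt0 ?muln_gt0 ?fact_gt0 ?expn_gt0 ?Y0//.
  by rewrite ler_nat.
move=> /le_trans h /h; rewrite leNgt => /negP; apply.
have YR : 0 < Y%:R :> R by rewrite ltr0n.
rewrite powRN ltr_pdivrMr ?powR_gt0// ltr_pdivlMl; last first.
  by rewrite ltr0n muln_gt0 fact_gt0 expn_gt0 Y0.
have -> : v' = (n.*2)%:R + (v' - (n.*2)%:R) by ring.
rewrite powRD; last by rewrite (lt0r_neq0 YR) implybT.
rewrite powR_mulrn ?ler0n// natrM natrX mulrAC [ltRHS]mulrC.
by rewrite ltr_pM2r ?exprn_gt0.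
Qed.

Section functional.
Variables (n : nat) (x : 'I_n.+1 -> int).

(** The integer linear form attached to an approximation x of the powers of xi up
    to the factor x_0: it is p-adically close to x_0 F(xi). *)
Definition pairing (F : {poly int}) : int := \sum_(i < n.+1) F`_i * x i.

Lemma pairingD F G : pairing (F + G) = pairing F + pairing G.
Proof. by rewrite -big_split; apply: eq_bigr => i _; rewrite coefD mulrDl. Qed.

Lemma pairingC c : pairing c%:P = c * x ord0.
Proof.
rewrite /pairing big_ord_recl coefC /= big1 ?addr0// => i _.
by rewrite coefC mul0r.
Qed.

Lemma pairingM (u F : {poly int}) :
  pairing (u * F) = \sum_(j < size u) u`_j * pairing ('X^j * F).
Proof.
rewrite -[in LHS](coefK u) poly_def mulr_suml /pairing.
under [RHS]eq_bigr => j _ do rewrite mulr_sumr.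
rewrite exchange_big /=; apply: eq_bigr => i _.
rewrite coef_sum mulr_suml; apply: eq_bigr => j _.
by rewrite -scalerAl coefZ mulrA.
Qed.

Lemma pairing_le (F : {poly int}) :
  (`|pairing F| <= n.+1 * (height F * \max_(i < n.+1) `|x i|))%N.
Proof.
apply: leq_trans (absz_sum _ _ _) _.
apply: leq_trans (_ : \sum_(i < n.+1) height F * \max_(i < n.+1) `|x i| <= _)%N.
  by apply: leq_sum => i _; rewrite abszM leq_mul ?coef_le_height// leq_bigmax.
by rewrite sum_nat_const card_ord.
Qed.

Lemma pairing_abs (F : {poly int}) (e : R) : (size F <= n.+1)%N -> 0 <= e ->
  abs_at F <= e ->
  (forall i : 'I_n.+1, (0 < i)%N ->
    Qp_abs R ((x ord0)%:~R * xi ^+ i - (x i)%:~R) <= e) ->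
  Qp_abs R ((pairing F)%:~R : Qp p_pr) <= e.
Proof.
move=> sF e0 Fe xe.
have -> : (pairing F)%:~R = (x ord0)%:~R * (map_poly intr F).[xi] -
    \sum_(i < n.+1) (F`_i)%:~R *
      ((x ord0)%:~R * xi ^+ i - (x i)%:~R) :> Qp p_pr.
  rewrite (horner_map_intr xi sF) mulr_sumr -sumrB rmorph_sum.
  by apply: eq_bigr => i _; rewrite rmorphM/=; ring.
apply: Qp_absB_le.
  rewrite Qp_absM -[leRHS]mul1r.
  by apply: ler_pM; [exact: Qp_abs_ge0|exact: Qp_abs_ge0|exact: Qp_abs_int_le1|].
apply: Qp_abs_sum_le => // i _; rewrite Qp_absM -[leRHS]mul1r.
apply: ler_pM; [exact: Qp_abs_ge0|exact: Qp_abs_ge0|exact: Qp_abs_int_le1|].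
have [i0|] := posnP i; last exact: xe.
have -> : i = ord0 by apply: val_inj.
by rewrite expr0 mulr1 subrr Qp_abs0.
Qed.

(** A nonzero integer k satisfies |k| |k|_p >= 1. *)
Lemma pairing_eq0 (F : {poly int}) (X Y e : R) : (height F)%:R <= Y ->
  (\max_(i < n.+1) `|x i|)%N%:R <= X ->
  Qp_abs R ((pairing F)%:~R : Qp p_pr) <= e ->
  n.+1%:R * (Y * X) * e < 1 -> pairing F = 0.
Proof.
move=> FY xX Fe small; apply: contraTeq small => F0; rewrite -leNgt.
have e0 := le_trans (Qp_abs_ge0 R _) Fe.
have N0 : 0 < `|pairing F|%N%:R :> R by rewrite ltr0n absz_gt0.
have := le_trans (Qp_abs_int_ge R p_pr F0) Fe.
rewrite -[_^-1]mul1r ler_pdivrMr// mulrC => /le_trans; apply.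
rewrite ler_wpM2r//.
apply: le_trans (_ : (n.+1 * (height F * \max_(i < n.+1) `|x i|))%N%:R <= _).
  by rewrite ler_nat pairing_le.
by rewrite !natrM ler_wpM2l// ler_pM.
Qed.

End functional.

(** The form [pairing x] vanishes on the shifts of two coprime approximations of
    degree at most m, hence on their resultant as 2m <= n + 1. *)
Lemma lambda_admissible_le n m (l : R) : (0 < m)%N -> (m.*2 <= n.+1)%N ->
  lambda_hat_admissible n xi l -> l <= m%:R^-1.
Proof.
move=> m_gt0 mn adm; rewrite leNgt; apply/negP => l_big.
have m0 : 0 < m%:R :> R by rewrite ltr0n.
have l0 : 0 < l by apply: lt_trans l_big; rewrite invr_gt0.
have il_m : l^-1 < m%:R by rewrite -[ltRHS]invrK ltf_pV2 ?posrE ?invr_gt0.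
(* X will be Y^s: l s > 1 makes Y X X^(- l - 1) small, and v' > s + 1 makes
   Y X Y^(- v') small *)
pose s := (l^-1 + m%:R) / 2; pose v' := (s + m%:R) / 2 + 1.
have il0 : 0 < l^-1 by rewrite invr_gt0.
have [ils s_m] : l^-1 < s /\ s < m%:R by rewrite /s; split; lra.
have s0 : 0 < s := lt_trans il0 ils.
have mS : m.+1%:R = m%:R + 1 :> R by rewrite -natr1.
have [sv' v'm] : s + 1 < v' /\ v' < m.+1%:R by rewrite /v' mS; split; lra.
have v'1 : 1 < v' by apply: lt_trans sv'; rewrite ltrDr.
have sl : 0 < s * l - 1 by rewrite subr_gt0 -ltr_pdivrMr// mul1r.
have sv'0 : 0 < v' - (s + 1) by rewrite subr_gt0.
have [C C0 dir] := dirichlet R xi m.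
have approx : uniformly_approximable xi m m.+1%:R C.
  by near=> X; apply: dir; near: X; apply: nbhs_pinfty_ge; rewrite num_real.
have [X0 [_ adm_large]] := adm.
pose c := xi_size R xi ^+ m; pose N : R := n.+1%:R.
have [|Y [[Y1 YX YA YB] [P [Q [cop PQ]]]]] :=
  @coprime_approximants R p p_pr xi xi_transc m m.+1%:R v' C
    (fun Y => [/\ 1 < Y, Num.max 1 X0 < Y `^ s,
       N * c < Y `^ (v' - (s + 1)) & N < Y `^ (s * l - 1)]) v'1 v'm approx.
  near=> Y; split; near: Y; first exact/nbhs_pinfty_gt/num_real.
  - exact: near_lt_powR.
  - exact: near_lt_powR.
  - exact: near_lt_powR.
set X := Y%:R `^ s in YX.
have [X1 XX0] : 1 < X /\ X0 < X by move: YX; rewrite gt_max => /andP[].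
have X_gt0 := lt_trans ltr01 X1; have Y_gt0 := lt_trans ltr01 Y1.
have [x [xX]] := adm_large X XX0.
set L := \big[Num.max/0]_(i < n.+1 | _) _ => /andP[L0 LX].
have xL (i : 'I_n.+1) : (0 < i)%N ->
    Qp_abs R ((x ord0)%:~R * xi ^+ i - (x i)%:~R) <= X `^ (- l - 1).
  move=> i0; apply: le_trans LX.
  exact: (@le_bigmax_cond _ _ _ 0 i (fun i => (0 < i)%N)).
have Ysplit r : Y%:R `^ (r + s + 1) = Y%:R `^ r * X * Y%:R.
  by rewrite !powRD ?powRr1 ?ltW// (lt0r_neq0 Y_gt0) implybT.
have shift0 F j : F \in [:: P; Q] -> (j < m)%N -> pairing x ('X^j * F) = 0.
  move=> FPQ jm; have [_ sF hF vF] := PQ F FPQ.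
  have hXF : (height ('X^j * F))%:R <= Y%:R :> R.
    rewrite ler_nat; apply/height_leP => i; rewrite coefXnM; case: ifP => // _.
    exact: leq_trans (coef_le_height _ _) hF.
  have sXF : (size ('X^j * F)%R <= n.+1)%N.
    apply: leq_trans (size_polyMleq _ _) _; rewrite size_polyXn /=.
    by move: (size F) sF => k; clear -mn jm; lia.
  have vXF : abs_at ('X^j * F) <= c * Y%:R `^ (- v').
    rewrite abs_atXn ler_pM ?exprn_ge0 ?Qp_abs_ge0 ?abs_at_ge0//.
    by rewrite xi_powers_le// ltnW.
  pose e := Num.max (c * Y%:R `^ (- v')) (X `^ (- l - 1)).
  apply: (@pairing_eq0 n x _ X Y%:R e) => //.
    apply: pairing_abs => //.
    - by rewrite le_max powR_ge0 orbT.
    - by rewrite le_max vXF.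
    - by move=> i i0; rewrite le_max xL ?orbT.
  have NYX : 0 < N * (Y%:R * X) by rewrite !mulr_gt0// ltr0n.
  rewrite -/N mulrC -ltr_pdivlMr// mul1r gt_max; apply/andP; split.
    rewrite powRN ltr_pdivrMr ?powR_gt0// ltr_pdivlMl//.
    have -> : v' = v' - (s + 1) + s + 1 by ring.
    have -> : N * (Y%:R * X) * c = N * c * X * Y%:R by ring.
    by rewrite Ysplit !ltr_pM2r.
  have -> : - l - 1 = - (l + 1) by ring.
  rewrite powRN ltf_pV2 ?posrE ?powR_gt0// /X -powRrM.
  have -> : s * (l + 1) = s * l - 1 + s + 1 by ring.
  by rewrite Ysplit -mulrA [X * _]mulrC ltr_pM2r// mulr_gt0.
have Q_in : Q \in [:: P; Q] by rewrite !inE eqxx orbT.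
have [sP1 sP _ _] := PQ P (mem_head _ _).
have [sQ1 sQ _ _] := PQ Q Q_in.
have [[u1 u2] /= [su1 su2] res] := resultant_in_ideal sP1 sQ1.
have r0 : resultant P Q != 0.
  by rewrite resultant_eq0 -leqNgt; move: cop; rewrite coprimep_def => /eqP->.
have x0 : x ord0 = 0.
  have : resultant P Q * x ord0 = 0.
    rewrite -pairingC res pairingD !pairingM !big1 ?addr0// => j _.
      rewrite shift0 ?mulr0// -ltnS (leq_trans _ sP)// (leq_trans _ su2)//.
      by rewrite ltnS ltn_ord.
    rewrite shift0 ?mulr0 ?mem_head// -ltnS (leq_trans _ sQ)//.
    by rewrite (leq_trans _ su1)// ltnS ltn_ord.
  by move/eqP; rewrite mulf_eq0 (negPf r0) => /eqP.
have xi0 (i : 'I_n.+1) : (0 < i)%N -> x i = 0.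
  move=> i0; apply: contrapT => /eqP xi0.
  have := xL i i0; rewrite x0 mul0r sub0r Qp_absN.
  have -> : - l - 1 = - (l + 1) by ring.
  move=> /(le_trans (Qp_abs_int_ge R p_pr xi0)).
  have lt_XV : X `^ (- (l + 1)) < X^-1 by apply: powRN_ltV => //; rewrite ltrDr.
  move=> /le_lt_trans/(_ lt_XV); rewrite ltf_pV2 ?posrE ?ltr0n ?absz_gt0//.
  by rewrite ltNge (le_trans _ xX)// ler_nat leq_bigmax.
move: L0; rewrite ltNge => /negP; apply; apply: bigmax_le => // i i0.
by rewrite x0 mul0r sub0r xi0// oppr0 Qp_abs0.
Unshelve. all: by end_near. Qed.

End exponents.

Local Open Scope ereal_scope.

Theorem theorem2p10 (R : realType) (p : nat) (p_pr : prime p)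
    (n : nat) (n_gt0 : (0 < n)%N) (xi : Qp p_pr)
    (xi_transc : ~ algebraicOver (ratr : rat -> Qp p_pr) xi) :
  w_hat R n xi <= (2 * n%:R - 1)%R%:E /\
  lambda_hat R n xi <= ((Num.ceil (n%:R / 2 : R)%R)%:~R^-1)%R%:E.
Proof.
split; apply: ge_ereal_sup => _ [w w_adm <-]; rewrite lee_fin.
  exact: w_admissible_le w_adm.
rewrite ceil_half; apply: lambda_admissible_le w_adm => //; lia.
Qed.
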